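(* The following two statements are equivalent. (A) For every regular pair $(d;a)=(d_1,\ldots,d_c;a_0,\ldots,a_n)$ with $c\leq 3$, $c\leq n$ and $a_i\neq 1$ for all $i$, one has $\delta(d;a)\geq F(a_0,\ldots,a_n)$. (B) For every integer $h\geq 1$ and every $h$-regular pair $(d;a)=(d_1,\ldots,d_c;a_0,\ldots,a_n)$ with $c\leq 3$, $c\leq n$ and $a_i\nmid h$ for all $i$, one has $\delta(d;a)\geq F^h(a_0,\ldots,a_n)$.
   Context: A pair $(d;a)=(d_1,\ldots,d_c;a_0,\ldots,a_n)$ consists of two tuples of positive integers, the degrees $d_i$ and the weights $a_j$. For a positive integer $h$, the pair is $h$-regular if for every non-empty subset $I=\{i_1,\ldots,i_k\}\subset\{0,\ldots,n\}$ (with $k$ elements) such that $a_I:=\gcd(a_{i_1},\ldots,a_{i_k})>1$, at least one of the following holds: (i) there exist $k$ distinct indices $p_1,\ldots,p_k\in\{1,\ldots,c\}$ such that $a_I$ divides each of $d_{p_1},\ldots,d_{p_k}$; (ii) $a_I\mid h$. A regular pair is a $1$-regular pair. The amplitude of the pair is $\delta(d;a)=\sum_{i=1}^c d_i-\sum_{j=0}^n a_j$. For positive integers $m_1,\ldots,m_k$ with $\gcd(m_1,\ldots,m_k)=1$, let $S=\langle m_1,\ldots,m_k\rangle$ be the set of their non-negative integer linear combinations. For $h\geq 1$, $F^h(m_1,\ldots,m_k)=\max\big(h\mathbb{Z}\setminus(h\mathbb{Z}\cap S)\big)$, the largest multiple of $h$ not in $S$ (it equals $-h$ if some $m_i$ divides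 $h$), and $F=F^1$ is the Frobenius number. If $g=\gcd(m_1,\ldots,m_k)>1$, then by convention $F^h(m_1,\ldots,m_k)=g\,F^{h/G}(m_1/g,\ldots,m_k/g)$ with $G=\gcd(g,h)$. *)

(* Defs.v *)
From mathcomp Require Import all_boot all_order all_algebra.
From mathcomp Require Import boolp classical_sets.
Set Implicit Arguments.
Unset Strict Implicit.
Unset Printing Implicit Defensive.
Import Order.TTheory GRing.Theory Num.Theory.

Local Open Scope ring_scope.
Local Open Scope classical_set_scope.

Definition positive (k : nat) (m : 'I_k -> nat) : Prop :=
  forall i, (0 < m i)%N.

Definition gcd_on (k : nat) (m : 'I_k -> nat) (I : {set 'I_k}) : nat :=
  \big[gcdn/0%N]_(i in I) m i.

Definition gcd_all (k : nat) (m : 'I_k -> nat) : nat := gcd_on m [set: 'I_k].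

(* The k distinct indices p_1, ..., p_k are given by the set J of their values. *)
Definition h_regular (h c n : nat) (d : 'I_c -> nat) (a : 'I_n.+1 -> nat) :
    Prop :=
  forall I : {set 'I_n.+1}, I != finset.set0 -> (1 < gcd_on a I)%N ->
    (exists J : {set 'I_c},
        #|J| = #|I| /\ forall p, p \in J -> (gcd_on a I %| d p)%N)
    \/ (gcd_on a I %| h)%N.

Definition regular (c n : nat) (d : 'I_c -> nat) (a : 'I_n.+1 -> nat) : Prop :=
  h_regular 1 d a.

Definition amplitude (c n : nat) (d : 'I_c -> nat) (a : 'I_n.+1 -> nat) : int :=
  (\sum_i d i)%N%:Z - (\sum_j a j)%N%:Z.

Definition semigroup (k : nat) (m : 'I_k -> nat) : set int :=
  [set z | exists x : 'I_k -> nat, z = (\sum_i x i * m i)%N%:Z].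

Definition multiples (h : nat) : set int := [set z | (h%:Z %| z)%Z].

Definition is_max (A : set int) (z : int) : Prop :=
  A z /\ forall y, A y -> y <= z.

(* The value 0 is junk, taken only when A has no maximum. *)
Definition max_int (A : set int) : int := xget 0 (is_max A).

Definition frob_coprime (h k : nat) (m : 'I_k -> nat) : int :=
  max_int (multiples h `\` (multiples h `&` semigroup m)).

Lemma gcd_all_bezout (k : nat) (m : 'I_k -> nat) (M : nat) : (0 < M)%N ->
  exists u : 'I_k -> nat, (\sum_i u i * m i)%N = gcd_all m %[mod M].
Proof.
move=> M0; rewrite /gcd_all /gcd_on.
apply: (big_ind (fun z => exists u : 'I_k -> nat,
  (\sum_i u i * m i)%N = z %[mod M])).
- by exists (fun=> 0%N); rewrite big1.
- move=> x y [u hu] [v hv]; case: (posnP x) => [->|x0].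
    by exists v; rewrite gcd0n.
  case: (egcdnP y x0) => p q hpq _.
  exists (fun i => p * u i + (M.-1 * q) * v i)%N.
  have -> : (\sum_i (p * u i + M.-1 * q * v i) * m i
      = p * (\sum_i u i * m i) + M.-1 * q * (\sum_i v i * m i))%N.
    rewrite !big_distrr -big_split /=; apply: eq_bigr => i _.
    by rewrite mulnDl !mulnA.
  rewrite -modnDm -modnMmr hu modnMmr -[in X in (_ + X)%N]modnMmr hv modnMmr.
  rewrite modnDm hpq -mulnA addnAC -mulSn prednK //.
  by rewrite -modnDml mulnC modnMl add0n.
- move=> i _; exists (fun j => nat_of_bool (j == i)); rewrite (bigD1 i) //= eqxx mul1n.
  by rewrite big1 ?addn0 // => j /negbTE ->.
Qed.

Lemma semigroup_cofinite (k : nat) (m : 'I_k -> nat) : positive m ->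
  gcd_all m = 1%N -> exists N : nat, forall z, N%:Z <= z -> semigroup m z.
Proof.
case: k m => [|k] m mpos m1; first by move: m1; rewrite /gcd_all /gcd_on big1 // => -[].
have M0 := mpos ord0; set M := m ord0 in M0.
have [u hu] := gcd_all_bezout m M0; rewrite m1 in hu.
set E := (\sum_i u i * m i)%N in hu.
exists (M * E)%N => -[n|n]; last by [].
rewrite lez_nat => le_n.
have le_r : (n %% M * E <= n)%N.
  by apply: leq_trans le_n; rewrite leq_mul2r ltnW ?orbT // ltn_mod.
have /dvdnP[s hs] : (M %| n - n %% M * E)%N.
  by rewrite -eqn_mod_dvd // -modnMmr hu modnMmr muln1 modn_mod.
exists (fun i => s * (i == ord0) + n %% M * u i)%N; congr Posz.
rewrite -[LHS](subnK le_r) hs.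
rewrite (eq_bigr (fun i => s * ((i == ord0) * m i) + n %% M * (u i * m i)))%N;
  last by move=> i _; rewrite mulnDl !mulnA.
rewrite big_split /= -!big_distrr /= -/E (bigD1 ord0) //= mul1n big1 ?addn0 //.
by move=> i /negbTE ->.
Qed.

(* The maximum defining frob_coprime exists, so that the junk value of
   max_int is never used. *)
Lemma frob_coprimeP (h k : nat) (m : 'I_k -> nat) : (0 < h)%N -> positive m ->
  gcd_all m = 1%N ->
  is_max (multiples h `\` (multiples h `&` semigroup m)) (frob_coprime h m).
Proof.
move=> h0 mpos m1; rewrite /frob_coprime /max_int; set A := _ `\` _.
suff [z hz] : exists z, is_max A z by apply: (xgetPex 0); exists z.
have [N hN] := semigroup_cofinite mpos m1.
have ltN z : A z -> z <= N%:Z.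
  by move=> [hz nz]; case: (leP z N%:Z) => // /ltW /hN Sz; case: nz.
have Ah : A (- h%:Z).
  split; first by rewrite /multiples /= rpredN dvdzz.
  move=> [_ [x hx]]; have : 0 <= - h%:Z by rewrite hx.
  by rewrite oppr_ge0 lez_nat leqNgt h0.
have ex : exists n, `[< A (N%:Z - n%:Z) >].
  by exists (N + h)%N; apply/asboolP; rewrite PoszD opprD addrA subrr add0r.
case: (ex_minnP ex) => n /asboolP An nmin; exists (N%:Z - n%:Z); split=> // y Ay.
have := ltN _ Ay; rewrite -subr_ge0; case E : (N%:Z - y) => [p|//] _.
have yE : y = N%:Z - p%:Z by rewrite -E opprB addrC subrK.
by rewrite yE lerD2l lerN2 lez_nat nmin //; apply/asboolP; rewrite -yE.
Qed.

Definition frob_h (h k : nat) (m : 'I_k -> nat) : int :=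
  let g := gcd_all m in
  if g == 1%N then frob_coprime h m
  else g%:Z * frob_coprime (h %/ gcdn g h) (fun i => (m i %/ g)%N).

Definition frob (k : nat) (m : 'I_k -> nat) : int := frob_h 1 m.

(* Main.v *)
Require Import Defs.
From mathcomp Require Import all_boot all_order all_algebra.
From mathcomp Require Import boolp zify.
Set Implicit Arguments.
Unset Strict Implicit.
Unset Printing Implicit Defensive.
Import Order.TTheory GRing.Theory Num.Theory.
Local Open Scope ring_scope.

(** That (B) implies (A) is the case h = 1. For the converse, fix an h-regular
pair (d; a) with c <= n and no a_i dividing h. Three remarks make it easy to
manipulate.

- The pair is h-regular exactly when, for each m not dividing h, at most as
  many weights as degrees are multiples of m: apply the definition to the set
  of all the weights divisible by m.
- Since c <= n, the gcd of all the weights divides h, so the inequality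
  delta(d; a) >= F^h(a) says that every multiple of h larger than delta(d; a)
  lies in the semigroup of the weights (frob_h_leP).
- In this form both notions make sense for lists, and behave well when one
  keeps only the multiples of some k, or divides some entries by a prime.

The proof is an induction on h + c, whose case h = 1 is (A). Let p be a prime
factor of h. Write D_k and W_k for the sums of the degrees and of the weights
that k does not divide.

If D_p <= W_p, divide by p all degrees and weights that are multiples of p.
The new pair is (h/p)-regular and p times its amplitude is at most
delta(d; a), so the bound for it and h/p, multiplied by p, gives the bound for
(d; a) (amp_bound_divide).

If the pair is (h/p)-regular, the bound for h/p is already stronger than the
bound for h.

Otherwise D_p > W_p, and there is a multiple k of p that divides strictly more
weights than degrees. One can choose k so that it divides the same weights as
p does (exists_excess_factor); this is where c <= 3 enters. Then
D_k >= D_p > W_p = W_k. The multiples of k among the degrees and the weights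
form an h-regular pair with fewer degrees, still fewer than the weights, whose
amplitude is at most that of (d; a) and whose semigroup is contained in that
of the weights a; so its bound implies the one sought (amp_bound_filter). *)

(** * Semigroups generated by lists *)

(** Only membership in the list matters here, so that replacing or removing
entries needs no bookkeeping of positions. *)
Inductive generated (s : seq nat) : nat -> Prop :=
| generated0 : generated s 0
| generatedD a z : a \in s -> generated s z -> generated s (a + z).

Lemma generated_sub (s t : seq nat) z :
  {subset s <= t} -> generated s z -> generated t z.
Proof.
move=> st; elim=> [|a y ys _ IH]; first exact: generated0.
by apply: generatedD => //; apply: st.
Qed.

Lemma generated_muln s k a z :
  a \in s -> generated s z -> generated s (k * a + z).
Proof.
move=> sa sz; elim: k => [//|k IH]; rewrite mulSn -addnA.
exact: generatedD.
Qed.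

Lemma semigroupE (k : nat) (m : 'I_k -> nat) (z : nat) :
  semigroup m z%:Z <-> generated (codom m) z.
Proof.
split=> [[x [->]]|].
  elim/big_rec: _ => [|i y _ IH]; first exact: generated0.
  by apply: generated_muln => //; apply: codom_f.
elim=> [|_ y /codomP[j ->] _ [x [->]]].
  by exists (fun=> 0%N); rewrite big1.
exists (fun i => (i == j) + x i)%N; congr Posz.
rewrite [in RHS](eq_bigr (fun i => (i == j) * m i + x i * m i)%N).
  rewrite big_split /=; congr (_ + _)%N.
  by rewrite (bigD1 j) //= eqxx mul1n big1 ?addn0 // => i /negbTE ->.
by move=> i _; rewrite mulnDl.
Qed.

(** * Regularity and the amplitude bound for lists *)

(** The counting form of h-regularity. Testing the set of all the weights
divisible by m suffices: their gcd is a multiple of m, hence does not divide h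
either. *)
Definition seq_regular (h : nat) (ds s : seq nat) : Prop :=
  forall m, ~~ (m %| h)%N -> (count (dvdn m) s <= count (dvdn m) ds)%N.

(** The inequality between amplitude and Frobenius number, in a form that needs
neither a maximum nor a convention on the gcd of the weights. *)
Definition amp_bound (h : nat) (ds s : seq nat) : Prop :=
  forall z : int, (h%:Z %| z)%Z -> (sumn ds)%:Z - (sumn s)%:Z < z ->
    exists2 n : nat, z = n%:Z & generated s n.

(** * Dividing by a prime factor of h *)

Definition divide_if (p a : nat) : nat := if (p %| a)%N then (a %/ p)%N else a.

Lemma divide_if_gt0 p a : (0 < a)%N -> (0 < divide_if p a)%N.
Proof.
rewrite /divide_if; case: ifP => // pa a0.
by rewrite divn_gt0 ?(dvdn_gt0 a0 pa) // (dvdn_leq a0 pa).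
Qed.

Lemma dvdn_divide_if p m a : prime p ->
  (m %| divide_if p a)%N = ((if p %| m then p * m else m) %| a)%N.
Proof.
move=> pr; have p0 := prime_gt0 pr; rewrite /divide_if.
case: ifP => pa; case: ifP => pm.
- by rewrite dvdn_divRL // mulnC.
- by rewrite -[in RHS](divnK pa) Gauss_dvdl // coprime_sym prime_coprime // pm.
- by apply/idP/idP => [/(dvdn_trans pm)|/(dvdn_trans (dvdn_mulr m (dvdnn p)))]; rewrite pa.
- by [].
Qed.

(** A divisor m of the new entries corresponds to the divisor p m of the old
ones if p divides m, and to m itself otherwise; either fails to divide h as
soon as m fails to divide h / p. *)
Lemma seq_regular_divide p h ds s : prime p -> (p %| h)%N ->
  seq_regular h ds s ->
  seq_regular (h %/ p) (map (divide_if p) ds) (map (divide_if p) s).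
Proof.
move=> pr ph reg m mh; have p0 := prime_gt0 pr.
rewrite !count_map !(eq_count (fun a => dvdn_divide_if m a pr)).
apply: reg; apply: contra mh; rewrite dvdn_divRL //.
case: ifP => pm; first by rewrite mulnC.
by move=> mh; rewrite Gauss_dvd ?mh ?ph // coprime_sym prime_coprime // pm.
Qed.

(** The entries prime to p are kept by [divide_if], so multiplying the new sum
by p counts them p times. Stated without subtraction. *)
Lemma sumn_divide_if p s :
  (p * sumn (map (divide_if p) s) + sumn [seq a <- s | ~~ (p %| a)]
   = sumn s + p * sumn [seq a <- s | ~~ (p %| a)])%N.
Proof.
elim: s => [|a s IH] /=; first by rewrite muln0.
rewrite {1}/divide_if; case: ifP => /= pa; last by rewrite !mulnDr; lia.
by rewrite mulnDr [(p * (a %/ p))%N]mulnC divnK //; lia.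
Qed.

Lemma generated_divide p s z :
  generated (map (divide_if p) s) z -> generated s (p * z).
Proof.
elim=> [|_ y /mapP[a sa ->] _ IH]; first by rewrite muln0; apply: generated0.
rewrite mulnDr /divide_if; case: ifP => pa; last exact: generated_muln.
by rewrite mulnC divnK //; apply: generatedD.
Qed.

(** Multiplication by p carries the new semigroup into the old one. The
hypothesis on the sums is exactly what makes p times the new amplitude at most
the old one. *)
Lemma amp_bound_divide p h ds s : prime p -> (p %| h)%N ->
  (sumn [seq d <- ds | ~~ (p %| d)] <= sumn [seq a <- s | ~~ (p %| a)])%N ->
  amp_bound (h %/ p) (map (divide_if p) ds) (map (divide_if p) s) ->
  amp_bound h ds s.
Proof.
move=> pr ph le cov z hz ltz; have p0 := prime_gt0 pr.
have /dvdzP[y yz] : (p%:Z %| z)%Z by apply: dvdz_trans hz.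
have [|| n ny gn] := cov y.
- by move: hz; rewrite yz -{1}(divnK ph) PoszM dvdz_mul2r //; lia.
- have := sumn_divide_if p s; have := sumn_divide_if p ds; nia.
- by exists (p * n)%N; [rewrite yz ny mulrC | apply: generated_divide].
Qed.

(** * Keeping only the multiples of k *)

Lemma sumn_split (P : pred nat) s :
  (sumn s = sumn (filter P s) + sumn [seq a <- s | ~~ P a])%N.
Proof. by elim: s => //= a s ->; case: (P a) => /=; lia. Qed.

(** Among the multiples of k, the multiples of m are the multiples of lcm(m, k),
which does not divide h when m does not. *)
Lemma seq_regular_filter k h ds s : seq_regular h ds s ->
  seq_regular h (filter (dvdn k) ds) (filter (dvdn k) s).
Proof.
move=> reg m mh.
have E t : count (dvdn m) (filter (dvdn k) t) = count (dvdn (lcmn m k)) t.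
  by rewrite count_filter; apply: eq_count => a /=; rewrite dvdn_lcm.
rewrite !E; apply: reg; apply: contra mh; apply: dvdn_trans.
exact: dvdn_lcml.
Qed.

Lemma amp_bound_filter (P Q : pred nat) h ds s :
  (sumn [seq a <- s | ~~ Q a] <= sumn [seq d <- ds | ~~ P d])%N ->
  amp_bound h (filter P ds) (filter Q s) -> amp_bound h ds s.
Proof.
move=> le cov z hz ltz; have [|n zn gn] := cov z hz.
  by have := sumn_split P ds; have := sumn_split Q s; lia.
exists n => //; apply: generated_sub gn => a.
by rewrite mem_filter => /andP[].
Qed.

Lemma sub_sumn_filter (P Q : pred nat) s : {in s, forall a, P a -> Q a} ->
  (sumn (filter P s) <= sumn (filter Q s))%N.
Proof.
elim: s => //= a s IH PQ.
have {}IH := IH (fun b bs => PQ b (@mem_behead _ (a :: s) b bs)).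
by have := PQ a (mem_head _ _); case: (P a) (Q a) => [] [] //= H; try lia; have := H isT.
Qed.

(** * Induction on h and on the number of degrees *)

(** A weight a fails to divide h, so regularity at m = a gives a degree
divisible by a, hence by every divisor of a. *)
Lemma seq_regular_count_gt0 h ds s k a : seq_regular h ds s -> ~~ (a %| h)%N ->
  a \in s -> (k %| a)%N -> (0 < count (dvdn k) ds)%N.
Proof.
move=> reg ah sa ka; have : (0 < count (dvdn a) s)%N.
  by rewrite -has_count; apply/hasP; exists a.
move/leq_trans/(_ (reg a ah))/leq_trans; apply; apply: sub_count => d.
exact: dvdn_trans.
Qed.

Lemma count_eq_in (P Q : pred nat) s : subpred P Q ->
  (count Q s <= count P s)%N -> {in s, P =1 Q}.
Proof.
move=> PQ; elim: s => //= a s IH le b.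
have le' := sub_count PQ s.
have Pab : P a = Q a.
  by have := PQ a; case: (P a) (Q a) le => [] [] //=; lia.
rewrite inE => /predU1P[-> //|]; apply: IH; move: le; rewrite Pab; lia.
Qed.

(** The failure of (h/p)-regularity is witnessed by some m that divides h but
not h / p; such an m is a multiple of p. If p itself divides more weights than
degrees, take k = p. If not, let alpha and beta count the weights and the
degrees. Some degree is prime to p, so beta(p) <= 2; some weight is a multiple
of m, so beta(m) >= 1. Then
1 <= beta(m) < alpha(m) <= alpha(p) <= beta(p) <= 2,
hence alpha(m) = alpha(p) = 2 and k = m divides the same weights as p. *)
Lemma exists_excess_factor p h ds s : prime p -> (p %| h)%N -> (0 < h)%N ->
  (size ds <= 3)%N -> seq_regular h ds s -> {in s, forall a, ~~ (a %| h)%N} ->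
  has (predC (dvdn p)) ds -> ~ seq_regular (h %/ p) ds s ->
  exists k, [/\ (p %| k)%N, (count (dvdn k) ds < count (dvdn k) s)%N
               & {in s, dvdn k =1 dvdn p}].
Proof.
move=> pr ph h0 ds3 reg nh hasp nreg.
have [m [pm mh mlt]] : exists m, [/\ (p %| m)%N, (m %| h)%N &
    (count (dvdn m) ds < count (dvdn m) s)%N].
  apply: contra_notP nreg => nex m mhp; rewrite leqNgt; apply/negP => mlt.
  have mh : (m %| h)%N by apply: contraLR mlt => /reg; rewrite -leqNgt.
  apply: nex; exists m; split=> //; apply: contraNT mhp => pm.
  rewrite -(@Gauss_dvdr _ p) ?[(p * _)%N]mulnC ?divnK //.
  by rewrite coprime_sym prime_coprime.
have [plt|ple] := ltnP (count (dvdn p) ds) (count (dvdn p) s).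
  by exists p.
exists m; split=> //.
have mp : subpred (dvdn m) (dvdn p) by move=> a /=; apply: dvdn_trans.
apply: count_eq_in => //.
have [a sa ma] : exists2 a, a \in s & (m %| a)%N.
  by apply/hasP; rewrite has_count; apply: leq_trans mlt.
have := seq_regular_count_gt0 reg (nh a sa) sa ma.
have := count_predC (dvdn p) ds.
by move: hasp; rewrite has_count; lia.
Qed.

(** Each step of the induction either replaces h by h / p with the same number
of degrees, or keeps h and loses a degree, so h + c decreases. *)
Lemma amp_bound_of_regular :
  (forall ds s, all (ltn 0) ds -> all (ltn 0) s -> seq_regular 1 ds s ->
     (size ds <= 3)%N -> (size ds < size s)%N -> 1%N \notin s ->
     amp_bound 1 ds s) ->
  forall h ds s, (0 < h)%N -> all (ltn 0) ds -> all (ltn 0) s ->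
    seq_regular h ds s -> (size ds <= 3)%N -> (size ds < size s)%N ->
    {in s, forall a, ~~ (a %| h)%N} -> amp_bound h ds s.
Proof.
move=> base h ds s; have [N] := ubnP (h + size ds).
elim: N h ds s => // N IH h ds s leN h0 ds0 s0 reg ds3 dss nh.
have [h1|h_gt1] : h = 1%N \/ (1 < h)%N by lia.
  rewrite h1 in reg nh *; apply: base => //.
  by apply/negP => /nh.
have [p pr ph] : exists2 p, prime p & (p %| h)%N.
  by exists (pdiv h); [exact: pdiv_prime | exact: pdiv_dvd].
have p1 := prime_gt1 pr.
have hp0 : (0 < h %/ p)%N by rewrite divn_gt0 ?prime_gt0 // (dvdn_leq h0 ph).
have hplt : (h %/ p < h)%N by rewrite ltn_Pdiv.
have [small|big] := leqP (sumn [seq d <- ds | ~~ (p %| d)%N])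
                         (sumn [seq a <- s | ~~ (p %| a)%N]).
  apply: (amp_bound_divide pr ph small); apply: IH; rewrite ?size_map //.
  - by lia.
  - by rewrite all_map; apply: sub_all ds0 => a; apply: divide_if_gt0.
  - by rewrite all_map; apply: sub_all s0 => a; apply: divide_if_gt0.
  - exact: seq_regular_divide.
  - move=> _ /mapP[a /nh ah ->]; rewrite dvdn_divRL //; apply: contra ah.
    rewrite /divide_if; case: ifP => pa; first by rewrite divnK.
    by apply: dvdn_trans; rewrite dvdn_mulr.
have hasp : has (predC (dvdn p)) ds.
  apply: contraLR big => /hasPn nd; rewrite -leqNgt.
  rewrite (_ : filter _ ds = [::]) // -(filter_pred0 ds).
  by apply: eq_in_filter => d /nd /negbTE.
have [regp|nregp] := pselect (seq_regular (h %/ p) ds s).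
  move=> z hz; apply: (IH (h %/ p)%N) => //; first by lia.
    by move=> a /nh; apply: contra => /dvdn_trans; apply; apply: dvdn_div.
  by apply: dvdz_trans hz; apply: dvdn_div.
have [k [pk klt kp]] := exists_excess_factor pr ph h0 ds3 reg nh hasp nregp.
have k_gt0 : (0 < count (dvdn k) s)%N by apply: leq_trans klt.
apply: (@amp_bound_filter (dvdn k) (dvdn k)).
  rewrite (_ : filter _ s = [seq a <- s | ~~ (p %| a)%N]); last first.
    by apply: eq_in_filter => a sa; rewrite kp.
  apply: leq_trans (ltnW big) _; apply: sub_sumn_filter => a _ /=.
  exact/contra/dvdn_trans.
(* A degree not divisible by p is lost, so the number of degrees drops. *)
have kds : (count (dvdn k) ds < size ds)%N.
  have := count_predC (dvdn p) ds; move: hasp; rewrite has_count.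
  have : (count (dvdn k) ds <= count (dvdn p) ds)%N.
    by apply: sub_count => d; apply: dvdn_trans.
  by lia.
apply: IH; rewrite ?size_filter //; try lia.
- by apply/allP => d; rewrite mem_filter => /andP[_]; apply/allP.
- by apply/allP => d; rewrite mem_filter => /andP[_]; apply/allP.
- exact: seq_regular_filter.
- by move=> a; rewrite mem_filter => /andP[_ /nh].
Qed.

(** * Frobenius numbers and regular pairs of families *)

Lemma frob_coprime_leP (h k : nat) (m : 'I_k -> nat) (D : int) :
  (0 < h)%N -> positive m -> gcd_all m = 1%N ->
  frob_coprime h m <= D <->
  (forall z : int, (h%:Z %| z)%Z -> D < z -> semigroup m z).
Proof.
move=> h0 m0 m1; have [[hF nF] maxF] := frob_coprimeP h0 m0 m1.
split=> [FD z hz Dz|cov].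
  apply: contrapT => nz.
  suff /(lt_le_trans Dz) : z <= D by rewrite ltxx.
  by apply: le_trans FD; apply: maxF; split=> // -[].
by rewrite leNgt; apply/negP => /(cov _ hF) SF; apply: nF.
Qed.

Lemma gcd_all_divn (k : nat) (m : 'I_k -> nat) : (0 < gcd_all m)%N ->
  gcd_all (fun i => m i %/ gcd_all m)%N = 1%N.
Proof.
move=> g0; apply/eqP; rewrite -(eqn_pmul2l g0) muln1; apply/eqP.
set g := gcd_all m; rewrite /gcd_all /gcd_on.
rewrite (big_morph (muln g) (muln_gcdr g) (muln0 g)).
(* The right-hand side g is by definition the gcd of the m i. *)
apply: eq_bigr => i _; rewrite mulnC divnK //.
by apply: biggcdn_inf; rewrite ?inE.
Qed.

Lemma semigroup_mul (k : nat) (m m' : 'I_k -> nat) (g : nat) (z : int) :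
  (0 < g)%N -> (forall i, m i = g * m' i)%N ->
  semigroup m (g%:Z * z) <-> semigroup m' z.
Proof.
move=> g0 mE.
have E x : (\sum_i x i * m i = g * \sum_i x i * m' i)%N.
  by rewrite big_distrr; apply: eq_bigr => i _; rewrite mE mulnCA.
split=> -[x xz]; exists x; last by rewrite xz E PoszM.
by move: xz; rewrite E PoszM => /mulfI; apply; lia.
Qed.

(** When the gcd g of the weights divides h, both the multiples of h and the
semigroup consist of multiples of g, and dividing by g leads to the coprime
case. *)
Lemma frob_h_leP (h k : nat) (m : 'I_k -> nat) (D : int) :
  (0 < h)%N -> positive m -> (gcd_all m %| h)%N ->
  frob_h h m <= D <->
  (forall z : int, (h%:Z %| z)%Z -> D < z -> semigroup m z).
Proof.
move=> h0 m0 gh; rewrite /frob_h; case: eqP => [/frob_coprime_leP|_]; first exact.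
have g0 : (0 < gcd_all m)%N by apply: dvdn_gt0 gh.
rewrite (gcdn_idPl gh).
set g := gcd_all m in gh g0 *; set m' := fun i => _.
have gm i : (g %| m i)%N by apply: biggcdn_inf; rewrite ?inE.
have mE i : m i = (g * m' i)%N by rewrite mulnC divnK.
have g0z : 0 < g%:Z by [].
rewrite mulrC -lez_divRL // frob_coprime_leP; last 3 first.
- by rewrite divn_gt0 // dvdn_leq.
- by move=> i; rewrite divn_gt0 // dvdn_leq.
- exact: gcd_all_divn.
have dvE z : (h%:Z %| g%:Z * z)%Z = ((h %/ g)%N%:Z %| z)%Z.
  by rewrite -{1}(divnK gh) PoszM mulrC dvdz_mul2r //; lia.
split=> [cov z hz Dz|cov z hz Dz]; last first.
  by apply/(semigroup_mul _ g0 mE)/cov; rewrite ?dvE // mulrC -ltz_divLR.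
have /dvdzP[y yz] : (g%:Z %| z)%Z by apply: dvdz_trans hz.
move: hz Dz; rewrite {}yz [y * _]mulrC dvE [_ * y]mulrC -ltz_divLR // => hy Dy.
by rewrite mulrC; apply/(semigroup_mul _ g0 mE)/cov.
Qed.

Lemma gcd_on_dvd (k : nat) (m : 'I_k -> nat) (I : {set 'I_k}) q :
  (q %| gcd_on m I)%N = (I \subset [set i | q %| m i]%N).
Proof.
apply/dvdn_biggcdP/subsetP => sub i /sub; first by rewrite inE.
by rewrite inE.
Qed.

Lemma count_codom (k : nat) (m : 'I_k -> nat) (P : pred nat) :
  count P (codom m) = #|[set i | P (m i)]|.
Proof.
rewrite codomE count_map enumT cardE size_filter; apply: eq_count => i.
by rewrite -[RHS]/(i \in _) inE.
Qed.

(** Regularity for the set of all n + 1 weights cannot hold through n + 1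
distinct degrees, as there are only c <= n of them. *)
Lemma gcd_all_dvd_of_regular (h c n : nat) (d : 'I_c -> nat)
    (a : 'I_n.+1 -> nat) :
  positive a -> h_regular h d a -> (c <= n)%N -> (gcd_all a %| h)%N.
Proof.
move=> a0 reg cn; have [g1|] := leqP (gcd_all a) 1.
  have : (gcd_all a %| a ord0)%N by apply: biggcdn_inf; rewrite ?inE.
  by move/(dvdn_gt0 (a0 _)) => g0; rewrite (_ : gcd_all a = 1%N) //; lia.
move/(reg [set: 'I_n.+1]%SET) => [|[J [cardJ _]]|//].
  by apply/set0Pn; exists ord0; rewrite inE.
by have := max_card (mem J); rewrite cardJ cardsT !card_ord; lia.
Qed.

Lemma seq_regular_codom (h c n : nat) (d : 'I_c -> nat) (a : 'I_n.+1 -> nat) :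
  positive a -> h_regular h d a -> seq_regular h (codom d) (codom a).
Proof.
move=> a0 reg m mh; rewrite !count_codom.
set I := [set i | _]; have [->|In0] := eqVneq I set0; first by rewrite cards0.
have mI : (m %| gcd_on a I)%N by rewrite gcd_on_dvd.
have Ih : ~~ (gcd_on a I %| h)%N by apply: contra mh; apply: dvdn_trans.
have [i iI] := set0Pn _ In0.
have gi : (gcd_on a I %| a i)%N by apply: biggcdn_inf iI _.
have g0 := dvdn_gt0 (a0 i) gi.
have g1 : (1 < gcd_on a I)%N.
  by rewrite ltn_neqAle g0 andbT eq_sym; apply: contraNneq Ih => ->; rewrite dvd1n.
have [[J [<- Jd]]|] := reg I In0 g1; last by rewrite (negPf Ih).
apply: subset_leq_card; apply/subsetP => j /Jd gd; rewrite inE.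
exact: dvdn_trans gd.
Qed.

Lemma h_regular_codom (h c n : nat) (d : 'I_c -> nat) (a : 'I_n.+1 -> nat) :
  seq_regular h (codom d) (codom a) -> h_regular h d a.
Proof.
move=> reg I _ _; have [gh|/reg] := boolP (gcd_on a I %| h)%N; first by right.
rewrite !count_codom => le; left.
have {le} : (#|I| <= #|[set j | gcd_on a I %| d j]%N|)%N.
  by apply: leq_trans le; apply: subset_leq_card; rewrite -gcd_on_dvd.
case/card_geqP=> t [ut st tI]; exists [set j in t]; split.
  by rewrite cardsE; have /card_uniqP -> := ut.
by move=> p; rewrite inE => /tI; rewrite inE.
Qed.

Lemma amp_bound_codom (h c n : nat) (d : 'I_c -> nat) (a : 'I_n.+1 -> nat) :
  amp_bound h (codom d) (codom a) <->
  (forall z : int, (h%:Z %| z)%Z -> amplitude d a < z -> semigroup a z).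
Proof.
have sE k (m : 'I_k -> nat) : sumn (codom m) = (\sum_i m i)%N.
  by rewrite sumnE big_image.
rewrite /amp_bound !sE -/(amplitude d a); split=> cov z hz /(cov z hz).
  by case=> y -> /semigroupE.
by case: z {hz} => y; [move/semigroupE; exists y | case].
Qed.

Lemma amp_bound_codom_frob (h c n : nat) (d : 'I_c -> nat) (a : 'I_n.+1 -> nat) :
  (0 < h)%N -> positive a -> h_regular h d a -> (c <= n)%N ->
  frob_h h a <= amplitude d a <-> amp_bound h (codom d) (codom a).
Proof.
move=> h0 a0 reg cn; rewrite amp_bound_codom; apply: frob_h_leP => //.
exact: gcd_all_dvd_of_regular reg cn.
Qed.

Lemma codom_nth (s : seq nat) : codom (fun i : 'I_(size s) => nth 0%N s i) = s.
Proof.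
by rewrite codomE (map_comp (nth 0%N s) val) val_enum_ord -/(mkseq _ _) mkseq_nth.
Qed.

(** * The equivalence *)

Theorem theorem1p5 :
  (forall (c n : nat) (d : 'I_c -> nat) (a : 'I_n.+1 -> nat),
     positive d -> positive a -> regular d a ->
     (c <= 3)%N -> (c <= n)%N -> (forall i, a i <> 1%N) ->
     amplitude d a >= frob a)
  <->
  (forall (h c n : nat) (d : 'I_c -> nat) (a : 'I_n.+1 -> nat),
     (1 <= h)%N ->
     positive d -> positive a -> h_regular h d a ->
     (c <= 3)%N -> (c <= n)%N -> (forall i, ~~ (a i %| h)%N) ->
     amplitude d a >= frob_h h a).
Proof.
split=> [A h c n d a h0 d0 a0 reg c3 cn ah|B c n d a d0 a0 reg c3 cn a1]; last first.
  by apply: B => // i; rewrite dvdn1; apply/eqP.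
have codom_gt0 k (m : 'I_k -> nat) : positive m -> all (ltn 0) (codom m).
  by move=> m0; apply/allP => _ /codomP[i ->]; apply: m0.
apply/(amp_bound_codom_frob h0 a0 reg cn); apply: amp_bound_of_regular => //.
- move=> ds [//|b s] /allP ds0 /allP s0 dss_reg ds3 dss n1.
  pose d' := fun i : 'I_(size ds) => nth 0%N ds i.
  pose a' := fun i : 'I_(size s).+1 => nth 0%N (b :: s) i.
  have dE : codom d' = ds by apply: codom_nth.
  have aE : codom a' = b :: s by apply: (codom_nth (b :: s)).
  rewrite -dE -aE in dss_reg *.
  have reg' := h_regular_codom dss_reg.
  have d'0 : positive d' by move=> i; apply/ds0/mem_nth.
  have a'0 : positive a' by move=> i; apply/s0/mem_nth.
  apply/(amp_bound_codom_frob _ a'0 reg') => //; apply: A => // i ai1.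
  by move: n1; rewrite -ai1 mem_nth.
- exact: codom_gt0.
- exact: codom_gt0.
- exact: seq_regular_codom.
- by rewrite size_codom card_ord.
- by rewrite !size_codom !card_ord.
- by move=> _ /codomP[i ->].
Qed.
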